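(* Let $E=x_0^{d_1}\otimes\cdots\otimes x_0^{d_r}$, $n=n_1+\cdots+n_r$, and use the orthonormal basis of $T_E\mathbb X_{\mathbf n,\mathbf d}$ consisting of the tensors $e^{(i)}_k$ ($1\le i\le r$, $1\le k\le n_i$) obtained from $E$ by replacing the $i$-th factor $x_0^{d_i}$ by $\sqrt{d_i}\,x_0^{d_i-1}x_k$. Let $F\in N_E\mathbb X_{\mathbf n,\mathbf d}=\mathcal P\oplus\mathcal W\oplus\mathcal G$ be written $F=P+\sum_i W_i+\sum_{i<j}G_{i,j}$ with $P\in\mathcal P$, $W_i\in\mathcal W_i$, $G_{i,j}\in\mathcal G_{i,j}$, where $W_i$ is $E$ with the $i$-th factor replaced by $$f_i=\sum_{1\le k<\ell\le n_i}f_{i,(k,\ell)}\sqrt{d_i(d_i-1)}\,x_0^{d_i-2}x_kx_\ell+\sum_{1\le k\le n_i}f_{i,(k,k)}\sqrt{\tfrac{d_i(d_i-1)}{2}}\,x_0^{d_i-2}x_k^2$$ (set $f_{i,(\ell,k)}:=f_{i,(k,\ell)}$), and $G_{i,j}=\sum_{k=1}^{n_i}\sum_{\ell=1}^{n_j}g_{(i,j),(k,\ell)}\,E^{(i,j)}_{k,\ell}$, where $E^{(i,j)}_{k,\ell}$ is $E$ with the $i$-th factor replaced by $\sqrt{d_i}x_0^{d_i-1}x_k$ and the $j$-th factor replaced by $\sqrt{d_j}x_0^{d_j-1}x_\ell$. Then the Weingarten map $L_F$ of $\mathbb X_{\mathbf n,\mathbf d}$ at $E$ in direction $F$ is represented in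 this basis by the symmetric $n\times n$ block matrix with diagonal blocks $L_i$ and off-diagonal blocks $L_{i,j}$ (block $(j,i)$ equal to $L_{i,j}^T$), where $$L_i=\sqrt{\tfrac{d_i-1}{d_i}}\,\big(c_{k\ell}\,f_{i,(k,\ell)}\big)_{1\le k,\ell\le n_i},\quad c_{kk}=\sqrt2,\ c_{k\ell}=1\ (k\ne\ell),\qquad L_{i,j}=\big(g_{(i,j),(k,\ell)}\big)_{1\le k\le n_i,1\le \ell\le n_j}.$$ In particular $L_F$ depends only on the $\mathcal W$ and $\mathcal G$ components of $F$, and $L_F=0$ if $F\in\mathcal P$.
   Context: $H_{n,d}$: real homogeneous polynomials of degree $d$ in $x_0,\ldots,x_n$ with the Bombieri–Weyl inner product (scaled monomials $\mathbf m_\alpha=\sqrt{\binom d\alpha}x^\alpha$ orthonormal). $\mathbb V_{n,d}:=\{\pm\ell^d\}\cap\{\|f\|=1\}$; $\mathscr H_{\mathbf n,\mathbf d}:=H_{n_1,d_1}\otimes\cdots\otimes H_{n_r,d_r}$ with the inner product making all $\mathbf m_{\alpha_1}\otimes\cdots\otimes\mathbf m_{\alpha_r}$ orthonormal; $\mathbb X_{\mathbf n,\mathbf d}:=\{f_1\otimes\cdots\otimes f_r:f_i\in\mathbb V_{n_i,d_i}\}\subset$ unit sphere. With $(\alpha)_0:=\alpha_0$: $\mathcal W_i:=\operatorname{span}\{\mathbf m_{\alpha_1}\otimes\cdots\otimes\mathbf m_{\alpha_r}:(\alpha_i)_0=d_i-2,(\alpha_k)_0=d_k\ (k\ne i)\}$,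 $\mathcal G_{i,j}:=\operatorname{span}\{\mathbf m_{\alpha_1}\otimes\cdots\otimes\mathbf m_{\alpha_r}:(\alpha_i)_0=d_i-1,(\alpha_j)_0=d_j-1,(\alpha_k)_0=d_k\ (k\ne i,j)\}$ for $i<j$, $\mathcal W=\bigoplus\mathcal W_i$, $\mathcal G=\bigoplus_{i<j}\mathcal G_{i,j}$, $\mathcal P:=(\mathcal W\oplus\mathcal G)^\perp\cap N_E\mathbb X_{\mathbf n,\mathbf d}$; $N_E$ is the orthogonal complement of $T_E$ in $E^\perp$. The Weingarten map $L_F$ is defined by $\langle v,L_F(w)\rangle=\langle\partial v(u)/\partial w|_{u=E},F\rangle$ for tangent $v,w$ and any local tangent field $v(u)$ extending $v$. *)

(* Defs.v *)
From HB Require Import structures.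
From mathcomp Require Import all_boot all_order all_algebra.
From mathcomp Require Import boolp classical_sets reals topology normedtype derive.
Unset Printing Implicit Defensive.
Import Order.TTheory GRing.Theory Num.Theory.
Local Open Scope ring_scope.

Section SV.
Variable R : realType.

Definition mono (n d : nat) :=
  {a : {ffun 'I_n.+1 -> 'I_d.+1} | (\sum_j (a j : nat) == d)%N}.

(* Elements of H_{n,d}, given by their coordinates in the orthonormal
   Bombieri-Weyl basis  m_alpha = sqrt(binom d alpha) x^alpha. *)
Local Notation fvec n d := {ffun mono n d -> R^o}.

Definition multinom (n d : nat) (b : mono n d) : R :=
  (d`!)%:R / (\prod_j ((val b j : nat)`!))%:R.

Arguments multinom {n d}.

(* coordinates of the plain monomial x^a (a : exponent function);
   x^a = m_a / sqrt(binom(d,a)); zero vector if a is not a degree-d exponent *)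
Definition xmon (n d : nat) (a : 'I_n.+1 -> nat) : fvec n d :=
  [ffun b : mono n d => if [forall m, (val b m : nat) == a m]
                        then 1 / Num.sqrt (multinom b) else 0].

(* the linear form l = sum_j c_j x_j raised to the d-th power (multinomial expansion) *)
Definition lpow (n d : nat) (c : 'I_n.+1 -> R) : fvec n d :=
  \sum_(b : mono n d)
     (multinom b * \prod_m c m ^+ (val b m : nat)) *: xmon n d (fun m => val b m : nat).

Definition fnorm2 (n d : nat) (p : fvec n d) : R := \sum_b p b ^+ 2.

Arguments fnorm2 {n d}.
Definition inV (n d : nat) (p : fvec n d) : Prop :=
  exists (s : R) (c : 'I_n.+1 -> R),
    (s = 1 \/ s = -1) /\ p = s *: lpow n d c /\ fnorm2 p = 1.

Arguments inV {n d}.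

Definition expo0 (n d : nat) : 'I_n.+1 -> nat :=
  fun m => if m == ord0 then d else 0%N.
Definition expo1 (n d : nat) (k : 'I_n) : 'I_n.+1 -> nat :=
  fun m => if m == ord0 then (d - 1)%N else nat_of_bool (m == lift ord0 k).
Definition expo2 (n d : nat) (k l : 'I_n) : 'I_n.+1 -> nat :=
  fun m => if m == ord0 then (d - 2)%N
           else (nat_of_bool (m == lift ord0 k) + nat_of_bool (m == lift ord0 l))%N.

Variables (r : nat) (n d : 'I_r -> nat).

(* Index set of the orthonormal basis m_{alpha_1} (x) ... (x) m_{alpha_r}
   of the tensor space H_{n,d} = H_{n_1,d_1} (x) ... (x) H_{n_r,d_r}. *)
Local Notation tidx := {dffun forall i : 'I_r, mono (n i) (d i)}.
Local Notation vec := {ffun tidx -> R^o}.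

Definition ip (u v : vec) : R := \sum_t u t * v t.

Definition tens (p : forall i, fvec (n i) (d i)) : vec :=
  [ffun t : tidx => \prod_i p i (t i)].

Definition inX (u : vec) : Prop :=
  exists p : forall i, fvec (n i) (d i), (forall i, inV (p i)) /\ u = tens p.

Definition x0c (i : 'I_r) : fvec (n i) (d i) := xmon (n i) (d i) (expo0 (n i) (d i)).

Definition E : vec := [ffun t : tidx => \prod_i x0c i (t i)].

Definition repl (i : 'I_r) (q : fvec (n i) (d i)) : vec :=
  [ffun t : tidx => q (t i) * \prod_(j | j != i) x0c j (t j)].

Definition repl2 (i j : 'I_r) (q : fvec (n i) (d i)) (q' : fvec (n j) (d j)) : vec :=
  [ffun t : tidx => q (t i) * q' (t j) * \prod_(k | (k != i) && (k != j)) x0c k (t k)].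

Definition tfac (i : 'I_r) (k : 'I_(n i)) : fvec (n i) (d i) :=
  Num.sqrt (d i)%:R *: xmon (n i) (d i) (expo1 (n i) (d i) k).

Definition ebasis (a : {i : 'I_r & 'I_(n i)}) : vec := repl (projT1 a) (tfac (projT1 a) (projT2 a)).

Definition Eij (i j : 'I_r) (k : 'I_(n i)) (l : 'I_(n j)) : vec :=
  repl2 i j (tfac i k) (tfac j l).

(* f_i, with f i k l standing for f_{i,(k+1,l+1)} *)
Definition fpoly (i : 'I_r) (fi : nat -> nat -> R) : fvec (n i) (d i) :=
  \sum_(k < n i) \sum_(l < n i | (k < l)%N)
      (fi k l * Num.sqrt ((d i)%:R * ((d i)%:R - 1))) *: xmon (n i) (d i) (expo2 (n i) (d i) k l)
  + \sum_(k < n i)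
      (fi k k * Num.sqrt ((d i)%:R * ((d i)%:R - 1) / 2)) *: xmon (n i) (d i) (expo2 (n i) (d i) k k).

Definition Wvec (i : 'I_r) (fi : nat -> nat -> R) : vec := repl i (fpoly i fi).

Definition Gvec (i j : 'I_r) (gij : nat -> nat -> R) : vec :=
  \sum_(k < n i) \sum_(l < n j) gij k l *: Eij i j k l.

Definition delta (t0 : tidx) : vec := [ffun t : tidx => if t == t0 then 1 else 0].
Definition spanb (S : pred tidx) (u : vec) : Prop :=
  exists c : tidx -> R, u = \sum_(t | S t) c t *: delta t.

Definition a0 (t : tidx) (i : 'I_r) : nat := val (t i) ord0.

Definition inWi (i : 'I_r) : vec -> Prop :=
  spanb (fun t => (a0 t i + 2 == d i)%N && [forall k, (k != i) ==> (a0 t k == d k)]).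
Definition inGij (i j : 'I_r) : vec -> Prop :=
  spanb (fun t => [&& (a0 t i + 1 == d i)%N, (a0 t j + 1 == d j)%N &
                      [forall k, ((k != i) && (k != j)) ==> (a0 t k == d k)]]).

Definition velocity (gam : R -> vec) (w : vec) : Prop :=
  forall t, is_derive (0 : R^o) (1 : R^o) (fun s : R^o => gam s t) (w t).

Definition tangent (x w : vec) : Prop :=
  exists gam : R -> vec, (forall s, inX (gam s)) /\ gam 0 = x /\ velocity gam w.

Definition inNormalE (F : vec) : Prop :=
  ip F E = 0 /\ forall w, tangent E w -> ip F w = 0.

Definition inP (P : vec) : Prop :=
  inNormalE P /\
  (forall (i : 'I_r) w, inWi i w -> ip P w = 0) /\
  (forall (i j : 'I_r) w, (i < j)%N -> inGij i j w -> ip P w = 0).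

Definition tangent_field_nearE (V : vec -> vec) : Prop :=
  exists eps : R, 0 < eps /\
    forall x, inX x -> ip (x - E) (x - E) < eps -> tangent x (V x).

Definition Lmat (f : 'I_r -> nat -> nat -> R) (g : 'I_r -> 'I_r -> nat -> nat -> R)
  (a b : {i : 'I_r & 'I_(n i)}) : R :=
  let i := projT1 a in let k : nat := projT2 a in
  let j := projT1 b in let l : nat := projT2 b in
  if i == j then
    Num.sqrt (((d i)%:R - 1) / (d i)%:R) * (if k == l then Num.sqrt 2 else 1) * f i k l
  else if (i < j)%N then g i j k l else g j i l k.

End SV.

Arguments multinom {R n d}.
Arguments fnorm2 {R n d}.
Arguments inV {R n d}.
Arguments ip {R r n d}.
Arguments tens {R r n d}.
Arguments inX {R r n d}.
Arguments E R {r n d}.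
Arguments ebasis {R r n d}.
Arguments Wvec {R r n d}.
Arguments Gvec {R r n d}.
Arguments inWi {R r n d}.
Arguments inGij {R r n d}.
Arguments velocity {R r n d}.
Arguments tangent {R r n d}.
Arguments inNormalE {R r n d}.
Arguments inP {R r n d}.
Arguments tangent_field_nearE {R r n d}.
Arguments Lmat {R r n} d.

Notation fvec R n d := {ffun mono n d -> R^o}.
Notation tidx r n d := {dffun forall i : 'I_r, mono (n i) (d i)}.
Notation vec R r n d := {ffun tidx r n d -> R^o}.

(* Main.v *)
(* In the coordinates y_t = x_t / sqrt(multinomial t), every point of X satisfies
   the Segre-Veronese quadrics y_t y_u = y_v y_w whenever the exponents satisfy
   t + u = v + w. Differentiating once along curves in X gives linear equations for
   every tangent vector; differentiating these equations along gam, with the field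
   V as tangent vector, determines the derivative D at E. Taking u to be the index of
   E and w the index of some e^(i)_k yields: the coordinates of D of order at least
   three in the variables x_1, x_2, ... vanish, and those of order two are explicit.
   The coordinates of order zero and one are not controlled, but there F vanishes
   because it is normal at E. So only W and G contribute to <D, F>. *)
Require Import Defs.
From HB Require Import structures.
From mathcomp Require Import all_boot all_order all_algebra.
From mathcomp Require Import boolp classical_sets reals topology normedtype derive trigo.
From mathcomp Require Import zify ring lra.
Import Order.TTheory GRing.Theory Num.Theory.
Import numFieldNormedType.Exports.
Local Open Scope ring_scope.

(** * Exponent arrays and the additive relations between them *)

Section Multiindices.
Context {r : nat} {n d : 'I_r -> nat}.
Implicit Types (t : tidx r n d) (a b : {i : 'I_r & 'I_(n i)}).

Definition mexp t j (m : 'I_(n j).+1) : nat := val (t j) m.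

Lemma mexp_inj t u : (forall j m, mexp t j m = mexp u j m) -> t = u.
Proof.
move=> h; apply/ffunP => j; apply/val_inj/ffunP => m.
exact/val_inj/h.
Qed.

Lemma mexp_sum t j : (\sum_m mexp t j m = d j)%N.
Proof. exact/eqP/(valP (t j)). Qed.

Lemma tidx_exists (e : forall j, 'I_(n j).+1 -> nat) :
  (forall j, \sum_m e j m = d j)%N -> exists t, forall j m, mexp t j m = e j m.
Proof.
move=> h.
have hm j : {b : mono (n j) (d j) | forall m, (val b m : nat) = e j m}.
  (* A single exponent is at most the total degree, so it fits the ordinal type used in [mono]. *)
  have le m : (e j m < (d j).+1)%N by rewrite ltnS -(h j) (bigD1 m) //= leq_addr.
  pose b := [ffun m => Ordinal (le m)].
  have hb : (\sum_m (b m : nat) == d j)%N.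
    by apply/eqP; rewrite -[RHS](h j); apply: eq_bigr => m _; rewrite ffunE.
  by exists (exist _ b hb) => m; rewrite /= ffunE.
exists [ffun j => sval (hm j)] => j m; rewrite /mexp ffunE.
exact: (svalP (hm j)).
Qed.

(** The comparison is made in [nat] because [m] and [tagged a] have comparable types only once
    [tag a = j]; the successor skips x_0. *)
Definition is_var a j (m : 'I_(n j).+1) : nat :=
  (tag a == j) && (m == (tagged a).+1 :> nat).

(* Exponents of E, of ebasis a, and of the second-order monomials x_a x_b. *)
Definition e0 j : 'I_(n j).+1 -> nat := expo0 (n j) (d j).
Definition e1 a j (m : 'I_(n j).+1) : nat :=
  if m == ord0 then (d j - (tag a == j))%N else is_var a j m.
Definition e2 a b j (m : 'I_(n j).+1) : nat :=
  if m == ord0 then (d j - (tag a == j) - (tag b == j))%N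
  else (is_var a j m + is_var b j m)%N.

Lemma sum_is_var a j : (\sum_(m < n j) is_var a j (lift ord0 m) = (tag a == j))%N.
Proof.
case: a => i k; rewrite /is_var /=; case: eqVneq => [e|_] /=; last by rewrite big1.
subst j; rewrite (bigD1 k) //= eqxx big1 // => m mk.
by rewrite eqSS (negbTE (mk : (m != k :> nat))).
Qed.

(* Guards the truncated subtractions in e2: x_a x_b has degree at most d_j in
   every factor. *)
Definition ord2 a b := forall j, ((tag a == j) + (tag b == j) <= d j)%N.

Hypothesis hd : forall i, (0 < d i)%N.

Lemma t0_exists : exists t, forall j m, mexp t j m = e0 j m.
Proof.
apply: tidx_exists => j; rewrite big_ord_recl /e0 /expo0 /= big1 ?addn0 //.
Qed.

Lemma t1_exists a : exists t, forall j m, mexp t j m = e1 a j m.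
Proof.
apply: tidx_exists => j; rewrite big_ord_recl {1}/e1 /=.
rewrite (eq_bigr (fun m => is_var a j (lift ord0 m))) // sum_is_var subnK //.
by case: eqP => // _; apply: hd.
Qed.

Lemma t2_exists a b : ord2 a b -> exists t, forall j m, mexp t j m = e2 a b j m.
Proof.
move=> /[dup] ab h; apply: tidx_exists => j; rewrite big_ord_recl {1}/e2 /=.
rewrite (eq_bigr (fun m => is_var a j (lift ord0 m) + is_var b j (lift ord0 m))%N) //.
by rewrite big_split /= !sum_is_var -subnDA subnK.
Qed.

Definition t0 := sval (cid t0_exists).
Definition t1 a := sval (cid (t1_exists a)).

Lemma mexp_t0 j m : mexp t0 j m = e0 j m. Proof. exact: svalP (cid t0_exists) j m. Qed.
Lemma mexp_t1 a j m : mexp (t1 a) j m = e1 a j m. Proof. exact: svalP (cid (t1_exists a)) j m. Qed.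

Lemma t1_inj : injective t1.
Proof.
move=> [i k] [j l] h.
have := mexp_t1 (Tagged _ l) j (lift ord0 l); rewrite -h mexp_t1 /e1 /is_var /= !eqxx /=.
case: eqP => //= e; subst j; rewrite eqSS; case: eqP => //= /val_inj -> //.
Qed.

Lemma t1_neq0 a : t1 a != t0.
Proof.
apply/eqP => h; have := mexp_t1 a (tag a) (lift ord0 (tagged a)).
by rewrite h mexp_t0 /e0 /expo0 /e1 /is_var /= !eqxx.
Qed.

(** This is the monomial identity (x_a x_b) E = (x_a)(x_b) after homogenization by x_0; [ord2] makes
    the truncated subtractions exact. *)
Lemma t2_quad t a b : ord2 a b -> (forall j m, mexp t j m = e2 a b j m) ->
  forall j m, (mexp t j m + mexp t0 j m = mexp (t1 a) j m + mexp (t1 b) j m)%N.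
Proof.
move=> ab h j m; rewrite h !mexp_t1 mexp_t0 /e2 /e0 /e1 /expo0.
case: eqP => _; last by rewrite addn0.
by have := ab j; case: (tag a == j); case: (tag b == j) => //=; lia.
Qed.

Lemma t2_neq0 t a b : (forall j m, mexp t j m = e2 a b j m) -> t != t0.
Proof.
move=> h; apply/eqP => ht; have := h (tag a) (lift ord0 (tagged a)).
by rewrite ht mexp_t0 /e0 /expo0 /e2 /is_var /= !eqxx.
Qed.

(** An index other than [t0] contains some variable x_a besides the x_0's. Trading one copy of x_a
    for x_0 produces [v], which supplies a quadric for every such coordinate. *)
Lemma t_split t : t != t0 -> exists a v,
  forall j m, (mexp t j m + mexp t0 j m = mexp v j m + mexp (t1 a) j m)%N.
Proof.
move=> tn.
have [[i k] hk] : exists a, (0 < mexp t (tag a) (lift ord0 (tagged a)))%N.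
  apply: contrapT => hn; case/eqP: tn; apply: mexp_inj => j m.
  have z (l : 'I_(n j)) : mexp t j (lift ord0 l) = 0%N.
    apply/eqP; rewrite -leqn0 leqNgt; apply/negP => h.
    by apply: hn; exists (Tagged (fun i => 'I_(n i)) l).
  rewrite mexp_t0 /e0 /expo0; case: (unliftP ord0 m) => [l ->|->]; rewrite ?z //=.
  by rewrite -(mexp_sum t j) big_ord_recl big1 ?addn0 // => l _; rewrite z.
(* The witness is v = t + t0 - t1 a; [le] shows that nothing is truncated. *)
have := @tidx_exists (fun j m => mexp t j m + mexp t0 j m - mexp (t1 (Tagged _ k)) j m)%N.
have le j m : (mexp (t1 (Tagged _ k)) j m <= mexp t j m + mexp t0 j m)%N.
  rewrite mexp_t0 mexp_t1 /e1 /e0 /expo0 /is_var /=.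
  case: eqP => [_|m0]; first lia.
  case: eqP => [e|] //=; subst j; case: eqP => //= e.
  by have -> : m = lift ord0 k; [exact/val_inj | exact: ltn_addr].
case=> [j|v hv].
  have := mexp_sum (t1 (Tagged _ k)) j; have := mexp_sum t0 j; have := mexp_sum t j.
  rewrite sumnB => [|m _]; last exact: le.
  by rewrite big_split /= => -> -> ->; lia.
by exists (Tagged (fun i => 'I_(n i)) k), v => j m; rewrite hv subnK.
Qed.

Lemma split_t0 t a : (forall j m, (mexp t j m + mexp t0 j m = mexp t0 j m + mexp (t1 a) j m)%N) ->
  t = t1 a.
Proof. by move=> h; apply: mexp_inj => j m; have := h j m; lia. Qed.

(** The exponents of x_0 give [ord2]: a factor of degree one cannot lose x_0 twice. *)
Lemma split_t1 t a b :
  (forall j m, (mexp t j m + mexp t0 j m = mexp (t1 b) j m + mexp (t1 a) j m)%N) ->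
  ord2 b a /\ forall j m, mexp t j m = e2 b a j m.
Proof.
move=> h; split=> [j|j m].
  have := h j ord0; rewrite mexp_t0 !mexp_t1 /e0 /e1 /expo0 /=.
  by have := hd j; case: (tag b == j); case: (tag a == j) => //=; lia.
have := h j m; rewrite mexp_t0 !mexp_t1 /e0 /e1 /e2 /expo0 /=.
by have := hd j; case: eqP => _; case: (tag b == j); case: (tag a == j) => //=; lia.
Qed.

End Multiindices.

(** * Derivatives at 0 of real functions *)

Section DerivativeAtZero.
Context {R : realType}.

Local Notation der p y := (is_derive (0 : R^o) (1 : R^o) (p : R^o -> R^o) (y : R^o)).

Lemma der_unique (p : R -> R) y z : der p y -> der p z -> y = z.
Proof. by move=> [_ <-] [_ <-]. Qed.

Lemma der_ext (p q : R -> R) y : p =1 q -> der p y -> der q y.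
Proof. by move=> /funext ->. Qed.

Lemma der_mul (p q : R -> R) y z : der p y -> der q z ->
  der (fun s => p s * q s) (p 0 * z + q 0 * y).
Proof. exact: is_deriveM. Qed.

Lemma der_add (p q : R -> R) y z : der p y -> der q z ->
  der (fun s => p s + q s) (y + z).
Proof. exact: is_deriveD. Qed.

Lemma der_cst (c : R) : der (fun=> c) 0.
Proof. exact: is_derive_cst. Qed.

Lemma der_sum (I : Type) (l : seq I) (p : I -> R -> R) (y : I -> R) :
  (forall i, der (p i) (y i)) ->
  der (fun s => \sum_(i <- l) p i s) (\sum_(i <- l) y i).
Proof.
move=> h; elim: l => [|i l IH].
  rewrite big_nil; apply: der_ext (der_cst 0) => s; by rewrite big_nil.
rewrite big_cons; apply: der_ext (der_add _ _ _ _ (h i) IH) => s.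
by rewrite big_cons.
Qed.

Lemma der_exp (p : R -> R) y k : der p y ->
  der (fun s => p s ^+ k) (k%:R * p 0 ^+ k.-1 * y).
Proof.
move=> py; elim: k => [|k IH].
  by rewrite !mul0r; apply: der_ext (der_cst 1) => s; rewrite expr0.
have -> : k.+1%:R * p 0 ^+ k.+1.-1 * y = p 0 * (k%:R * p 0 ^+ k.-1 * y) + p 0 ^+ k * y.
  case: k {IH} => [|k] /=; first by rewrite !mul0r mulr0 add0r mul1r.
  by rewrite [p 0 ^+ k.+1]exprS -[k.+2]addn1 natrD; ring.
by apply: der_ext (der_mul _ _ _ _ py IH) => s; rewrite exprS.
Qed.

(** Differentiability gives continuity; this will keep a curve through [E] inside the neighbourhood
    where a field is tangent. *)
Lemma der_near_lt (p : R -> R) y e : der p y -> p 0 < e ->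
  \forall s \near (0 : R^o), p s < e.
Proof.
move=> [/derivable1_diffP/differentiable_continuous h _] pe.
exact: (cvgr_lt (p 0) h).
Qed.

End DerivativeAtZero.

(** * The Segre-Veronese quadrics and their first and second derivatives *)

Section RankOne.
Context {R : realType} {r : nat} {n d : 'I_r -> nat}.
Implicit Types (t u v w : tidx r n d) (a b : {i : 'I_r & 'I_(n i)}) (x y : vec R r n d).

Lemma multinom_gt0 m k (b : mono m k) : 0 < multinom b :> R.
Proof.
by rewrite divr_gt0 // ltr0n ?fact_gt0 // prodn_gt0 // => j; rewrite fact_gt0.
Qed.

Definition sqrt_mult t : R := \prod_j Num.sqrt (multinom (t j)).

Lemma sqrt_mult_gt0 t : 0 < sqrt_mult t.
Proof. by apply: prodr_gt0 => j _; rewrite sqrtr_gt0 multinom_gt0. Qed.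

Lemma sqrt_mult_neq0 t : sqrt_mult t != 0.
Proof. by rewrite gt_eqF // sqrt_mult_gt0. Qed.

Lemma xmonE m k e (b : mono m k) : xmon R m k e b =
  if [forall i, (val b i : nat) == e i] then (Num.sqrt (multinom b))^-1 else 0.
Proof. by rewrite ffunE div1r. Qed.

Lemma prod_xmon (e : forall j, 'I_(n j).+1 -> nat) t :
  \prod_j xmon R (n j) (d j) (e j) (t j) =
  if [forall j, forall m, mexp t j m == e j m] then (sqrt_mult t)^-1 else 0.
Proof.
case: ifPn => [/forallP h|/forallPn[j hj]].
  by rewrite -prodfV; apply: eq_bigr => j _; rewrite xmonE h.
by rewrite (bigD1 j) //= xmonE (negbTE hj) mul0r.
Qed.

(* Dividing by sqrt_mult makes the coordinates of a rank-one tensor plain monomials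
   in the coefficients of its linear forms. *)
Definition ncoord x t : R := x t / sqrt_mult t.

(** Only the summand indexed by [b] is nonzero at [b], and the multinomial coefficient divided by
    its square root leaves that square root. *)
Lemma lpowE m k c (b : mono m k) :
  lpow R m k c b = Num.sqrt (multinom b) * \prod_i c i ^+ (val b i : nat).
Proof.
rewrite /lpow sum_ffunE (bigD1 b) //= [X in _ + X]big1 ?addr0 => [|b' b'b].
  rewrite !ffunE ifT; last exact/forallP.
  have e : multinom b / Num.sqrt (multinom b) = Num.sqrt (multinom b) :> R.
    rewrite -{1}(sqr_sqrtr (ltW (multinom_gt0 _ _ b))) expr2 mulfK //.
    by rewrite gt_eqF // sqrtr_gt0 multinom_gt0.
  by rewrite div1r /GRing.scale /= mulrAC e.
have f0 : [forall i, (val b i : nat) == val b' i] = false.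
  apply: contra_neqF b'b => /forallP h.
  by apply/val_inj/ffunP => i; apply/val_inj/eqP; rewrite eq_sym; exact: h.
by rewrite !ffunE f0 scaler0.
Qed.

(** The scalars of the factors multiply to [s], while the square roots from [lpowE] multiply to
    [sqrt_mult t] and cancel in [ncoord]. *)
Lemma inX_ncoord x : inX x -> exists (s : R) (c : forall j, 'I_(n j).+1 -> R),
  forall t, ncoord x t = s * \prod_j \prod_m c j m ^+ mexp t j m.
Proof.
case=> p [hp ->].
have [sc hsc] : exists sc : forall j, R * ('I_(n j).+1 -> R),
    forall j, p j = (sc j).1 *: lpow R (n j) (d j) (sc j).2.
  have h j : {sc : R * ('I_(n j).+1 -> R) | p j = sc.1 *: lpow R (n j) (d j) sc.2}.
    by apply: cid; have [s [c [_ [-> _]]]] := hp j; exists (s, c).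
  by exists (fun j => sval (h j)) => j; exact: svalP (h j).
exists (\prod_j (sc j).1), (fun j => (sc j).2) => t.
rewrite /ncoord ffunE.
under eq_bigr do rewrite hsc ffunE lpowE /GRing.scale /= mulrCA.
by rewrite big_split /= -/(sqrt_mult t) mulrAC divff ?sqrt_mult_neq0 // mul1r big_split.
Qed.

(* The quadrics cutting out the Segre-Veronese cone. *)
Lemma inX_quadric x t u v w :
  (forall j m, (mexp t j m + mexp u j m = mexp v j m + mexp w j m)%N) ->
  inX x -> ncoord x t * ncoord x u = ncoord x v * ncoord x w.
Proof.
move=> h /inX_ncoord[s [c hx]]; rewrite !hx [LHS]mulrACA [RHS]mulrACA -!big_split /=; congr (_ * _).
apply: eq_bigr => j _; rewrite -!big_split; apply: eq_bigr => m _ /=.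
by rewrite -!exprD h.
Qed.

Local Notation der p y := (is_derive (0 : R^o) (1 : R^o) (p : R^o -> R^o) (y : R^o)).

Lemma velocity_ncoord gam y t : velocity gam y -> der (fun s => ncoord (gam s) t) (ncoord y t).
Proof.
move=> /(_ t) h; have := der_mul _ _ _ _ h (der_cst (sqrt_mult t)^-1).
by rewrite mulr0 add0r mulrC.
Qed.

(** Product rule applied to [inX_quadric] along a curve that witnesses tangency. *)
Lemma tangent_quadric x y t u v w :
  (forall j m, (mexp t j m + mexp u j m = mexp v j m + mexp w j m)%N) ->
  tangent x y ->
  ncoord x t * ncoord y u + ncoord x u * ncoord y t =
  ncoord x v * ncoord y w + ncoord x w * ncoord y v.
Proof.
move=> h [gam [gX [<- gy]]].
have dp k l := der_mul _ _ _ _ (velocity_ncoord _ _ k gy) (velocity_ncoord _ _ l gy).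
apply: der_unique (dp t u) (der_ext _ _ _ _ (dp v w)) => s.
by rewrite (inX_quadric _ _ _ _ _ h).
Qed.

Lemma velocity_near gam y e : velocity gam y -> gam 0 = E R -> 0 < e ->
  \forall s \near (0 : R^o), ip (gam s - E R) (gam s - E R) < e.
Proof.
move=> hv h0 e0.
have dt t : der (fun s => (gam s - E R) t) (y t).
  have := der_add _ _ _ _ (hv t) (der_cst (- E R t)); rewrite addr0.
  by apply: der_ext => s; rewrite !ffunE.
apply: der_near_lt; first by apply: der_sum => t; apply: der_mul (dt t) (dt t).
by rewrite /ip big1 // => t _; rewrite h0 subrr ffunE mul0r.
Qed.

(** The vectors [V (gam s)] satisfy [tangent_quadric] as long as [gam s] is close to [E]. This holds
    for small [s], which is enough to differentiate the relation once more at 0. *)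
Lemma field_quadric V gam y z t u v w :
  (forall j m, (mexp t j m + mexp u j m = mexp v j m + mexp w j m)%N) ->
  tangent_field_nearE V -> (forall s, inX (gam s)) -> gam 0 = E R ->
  velocity gam y -> velocity (fun s => V (gam s)) z ->
  ncoord (E R) t * ncoord z u + ncoord (V (E R)) u * ncoord y t
    + (ncoord (E R) u * ncoord z t + ncoord (V (E R)) t * ncoord y u)
  = ncoord (E R) v * ncoord z w + ncoord (V (E R)) w * ncoord y v
    + (ncoord (E R) w * ncoord z v + ncoord (V (E R)) v * ncoord y w).
Proof.
move=> h [e [e0 VT]] gX g0 gy Vz; rewrite -g0.
have dp k l := der_mul _ _ _ _ (velocity_ncoord _ _ k gy) (velocity_ncoord _ _ l Vz).
have ds k l := der_add _ _ _ _ (dp k l) (dp l k).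
apply: der_unique (ds t u) (near_eq_is_derive _ (ds v w)).
have := velocity_near _ _ _ gy g0 e0; apply: filterS => s hs.
by rewrite (tangent_quadric _ _ _ _ _ _ h (VT _ (gX s) hs)).
Qed.

End RankOne.

(** * The multinomial theorem and the norm of a power of a linear form *)

Section Multinomial.
Context {R : realType}.

(** Truncation at degree [k] does not affect coefficients up to [k], so this is exp(y) exp(z) =
    exp(y + z), with the binomial theorem as induction step. *)
Lemma coef_prod_expo (I : Type) (l : seq I) (y : I -> R) k j : (j <= k)%N ->
  (\prod_(i <- l) \poly_(j < k.+1) (y i ^+ j / j`!%:R))`_j =
  (\sum_(i <- l) y i) ^+ j / j`!%:R.
Proof.
elim: l j => [|i l IH] j jk.
  by rewrite !big_nil coef1 expr0n; case: j jk => [|j] _ /=; rewrite ?divr1 ?mul0r.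
rewrite !big_cons coefM addrC exprDn mulr_suml; apply: eq_bigr => [[h hj]] _ /=.
have hk := leq_trans (hj : (h <= j)%N) jk.
rewrite coef_poly ltnS hk IH; last exact: leq_trans (leq_subr _ _) jk.
have fact0 m : (m`!)%:R != 0 :> R by rewrite pnatr_eq0 -lt0n fact_gt0.
rewrite -(bin_fact (hj : (h <= j)%N)) -mulr_natr !natrM; field.
by rewrite !fact0 pnatr_eq0 -lt0n bin_gt0 -ltnS hj.
Qed.

(* Compare the coefficients of X^k in the product of the truncated exponentials
   of y_i X. *)
Lemma multinomial_theorem m k (y : 'I_m.+1 -> R) :
  \sum_(b : mono m k) multinom b * \prod_i y i ^+ (val b i : nat) = (\sum_i y i) ^+ k.
Proof.
have fact0 j : (j`!)%:R != 0 :> R by rewrite pnatr_eq0 -lt0n fact_gt0.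
have := coef_prod_expo _ (index_enum 'I_m.+1) y _ _ (leqnn k).
move/(congr1 ( *%R^~ k`!%:R)); rewrite divfK // => <-.
under eq_bigr do rewrite poly_def.
rewrite bigA_distr_bigA /= coef_sum mulr_suml.
pose A := [pred a : {ffun 'I_m.+1 -> 'I_k.+1} | \sum_j (a j : nat) == k]%N.
(* In the expanded product only the exponent functions of total degree [k] contribute to X^k. *)
rewrite (bigID A) /= [X in _ + X]big1 ?addr0 => [|a /negbTE ak]; last first.
  by rewrite scaler_prod -expr_sum coefZ coefXn eq_sym ak mulr0 mul0r.
pose F (a : {ffun 'I_m.+1 -> 'I_k.+1}) : R :=
  k`!%:R / (\prod_j (a j)`!)%:R * \prod_i y i ^+ a i.
transitivity (\sum_(a in A) F a); last first.
  apply: eq_bigr => a ak; rewrite scaler_prod -expr_sum (eqP ak) coefZ coefXn eqxx.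
  by rewrite /F natr_prod mulr1 prodf_div mulrC [X in _ * X]mulrC mulrA.
rewrite (reindex_omap (val : mono m k -> _) insub) => [|a ak]; last by rewrite insubT.
by apply: eq_bigl => -[a ak] /=; rewrite insubT inE ak /= eqxx.
Qed.

(** The multinomial theorem for the squares of the coefficients. It reduces unit norm in the
    Bombieri-Weyl sense to unit norm of the coefficient vector. *)
Lemma fnorm2_lpow m k (c : 'I_m.+1 -> R) :
  fnorm2 (lpow R m k c) = (\sum_i c i ^+ 2) ^+ k.
Proof.
rewrite -multinomial_theorem; apply: eq_bigr => b _.
rewrite lpowE exprMn sqr_sqrtr ?ltW ?multinom_gt0 // -prodrXl; congr (_ * _).
by apply: eq_bigr => i _; rewrite exprAC.
Qed.

End Multinomial.

(** * The tangent basis at E and curves that realize it *)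

Section Tangent.
Context {R : realType} {r : nat} {n d : 'I_r -> nat}.
Hypothesis hd : forall i, (0 < d i)%N.
Implicit Types (t u v w : tidx r n d) (a b c : {i : 'I_r & 'I_(n i)}) (x y : vec R r n d).
Local Notation t0 := (@t0 r n d).
Local Notation t1 := (t1 hd).
Local Notation der p y := (is_derive (0 : R^o) (1 : R^o) (p : R^o -> R^o) (y : R^o)).

Lemma same_exponents (e : forall j, 'I_(n j).+1 -> nat) t u :
  (forall j m, mexp u j m = e j m) ->
  [forall j, forall m, mexp t j m == e j m] = (t == u).
Proof.
move=> h; apply/forallP/eqP => [tu|-> j]; last by apply/forallP => m; rewrite h.
by apply: mexp_inj => j m; rewrite h; apply/eqP; move: m; exact/forallP.
Qed.

Lemma multinom_mexp t j :
  multinom (t j) = (d j)`!%:R / (\prod_m (mexp t j m)`!)%:R :> R.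
Proof. by []. Qed.

Lemma sqrt_mult_t0 : sqrt_mult t0 = 1 :> R.
Proof.
rewrite /sqrt_mult big1 // => j _; rewrite multinom_mexp big_ord_recl big1 => [|m _].
  by rewrite mexp_t0 muln1 divff ?sqrtr1 // pnatr_eq0 -lt0n fact_gt0.
by rewrite mexp_t0.
Qed.

(** In the factor [tag a] the multinomial coefficient is d!/(d-1)! = d, elsewhere it is 1. Hence the
    sqrt(d_i) in [tfac] is exactly what normalizes [ebasis a]. *)
Lemma sqrt_mult_t1 a : sqrt_mult (t1 a) = Num.sqrt (d (tag a))%:R :> R.
Proof.
have mE j : multinom (t1 a j) = if tag a == j then (d j)%:R else 1 :> R.
  rewrite multinom_mexp big_ord_recl big1 => [|m _]; last first.
    by rewrite mexp_t1 /e1 /= /is_var; case: (_ && _).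
  rewrite muln1 mexp_t1 /e1 /=; case: eqP => _; last first.
    by rewrite subn0 divff // pnatr_eq0 -lt0n fact_gt0.
  rewrite -{1}(prednK (hd j)) factS (prednK (hd j)) subn1 natrM mulfK //.
  by rewrite pnatr_eq0 -lt0n fact_gt0.
rewrite /sqrt_mult (bigD1 (tag a)) //= mE eqxx big1 ?mulr1 // => j ja.
by rewrite mE eq_sym (negbTE ja) sqrtr1.
Qed.

Lemma ncoordK x t : ncoord x t * sqrt_mult t = x t.
Proof. by rewrite divfK // sqrt_mult_neq0. Qed.

Lemma E_val t : (E R) t = (t == t0)%:R.
Proof.
rewrite ffunE (prod_xmon (@e0 r n d)) (same_exponents _ _ t0); last exact: mexp_t0.
by case: eqP => // ->; rewrite sqrt_mult_t0 invr1.
Qed.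

Lemma ncoord_E t : ncoord (E R) t = (t == t0)%:R.
Proof.
by rewrite /ncoord E_val; case: eqP => [->|_]; rewrite ?mul0r // sqrt_mult_t0 divr1.
Qed.

Lemma repl_xmon i (q : 'I_(n i).+1 -> nat) (e : forall j, 'I_(n j).+1 -> nat) t :
  (forall m, e i m = q m) -> (forall j, j != i -> forall m, e j m = e0 (d := d) j m) ->
  repl R r n d i (xmon R (n i) (d i) q) t =
  if [forall j, forall m, mexp t j m == e j m] then (sqrt_mult t)^-1 else 0.
Proof.
move=> /funext <- h; rewrite ffunE -prod_xmon [RHS](bigD1 i) //=.
by congr (_ * _); apply: eq_bigr => j /h/funext ->.
Qed.

Lemma repl2_xmon i j (q : 'I_(n i).+1 -> nat) (q' : 'I_(n j).+1 -> nat)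
    (e : forall j, 'I_(n j).+1 -> nat) t :
  i != j -> (forall m, e i m = q m) -> (forall m, e j m = q' m) ->
  (forall k, k != i -> k != j -> forall m, e k m = e0 (d := d) k m) ->
  repl2 R r n d i j (xmon R (n i) (d i) q) (xmon R (n j) (d j) q') t =
  if [forall j, forall m, mexp t j m == e j m] then (sqrt_mult t)^-1 else 0.
Proof.
move=> ij /funext <- /funext <- h; rewrite ffunE -prod_xmon [RHS](bigD1 i) //=.
rewrite [X in _ = _ * X](bigD1 j) 1?eq_sym //= mulrA; congr (_ * _).
by apply: eq_bigr => k /andP[/h{}h /h/funext ->].
Qed.

Lemma ebasis_val a t : ebasis a t = (t == t1 a)%:R :> R.
Proof.
have -> : ebasis a t = Num.sqrt (d (tag a))%:R *
    repl R r n d (tag a) (xmon R _ _ (expo1 _ (d (tag a)) (tagged a))) t.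
  by rewrite !ffunE /GRing.scale /= mulrA.
rewrite (repl_xmon _ _ (@e1 r n d a)).
- rewrite (same_exponents _ _ (t1 a)); last exact: mexp_t1.
  case: eqP => [->|_]; last by rewrite mulr0.
  by rewrite sqrt_mult_t1 divff // gt_eqF // sqrtr_gt0 ltr0n.
- by move=> m; rewrite /e1 /expo1 /is_var eqxx.
- by move=> j; rewrite eq_sym => /negbTE ja m; rewrite /e1 /e0 /expo0 /is_var ja subn0.
Qed.

Lemma ncoord_ebasis a t :
  ncoord (ebasis a) t = (t == t1 a)%:R * (Num.sqrt (d (tag a))%:R)^-1 :> R.
Proof.
by rewrite /ncoord ebasis_val; case: eqP => [->|_]; rewrite ?mul0r // sqrt_mult_t1.
Qed.

Lemma ip_single x y t : (forall u, u != t -> y u = 0) -> ip x y = x t * y t.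
Proof.
by move=> h; rewrite /ip (bigD1 t) //= big1 ?addr0 // => u /h ->; rewrite mulr0.
Qed.

(* The rank-one tensor with factors (cos s x_0 + sin s x_k)^(d_i) at i = tag a,
   k = tagged a, and x_0^(d_j) elsewhere. *)
Definition rot a (s : R) j (m : 'I_(n j).+1) : R :=
  if m == ord0 then (if tag a == j then cos s else 1)
  else if is_var a j m == 1%N then sin s else 0.

Definition rot_curve a (s : R) : vec R r n d := tens (fun j => lpow R (n j) (d j) (rot a s j)).

(** By cos^2 + sin^2 = 1 every linear form has a unit coefficient vector, so [fnorm2_lpow]
    applies. *)
Lemma rot_curve_inX a s : inX (rot_curve a s).
Proof.
exists (fun j => lpow R (n j) (d j) (rot a s j)); split=> // j.
exists 1, (rot a s j); split; first by left.
rewrite scale1r fnorm2_lpow; split=> //.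
rewrite big_ord_recl {1}/rot /=; case: a => i k /=.
have [e|ij] := eqVneq i j; last first.
  by rewrite big1 ?addr0 ?expr1n // => m _; rewrite /rot /is_var /= (negbTE ij) expr0n.
subst j; rewrite (bigD1 k) //= big1 => [|m mk].
  by rewrite /rot /is_var /= !eqxx addr0 cos2Dsin2 expr1n.
by rewrite /rot /is_var /= eqxx eqSS (negbTE (mk : (m != k :> nat))) expr0n.
Qed.

(** Support condition of [rot_curve a]: where it fails, a zero coefficient of [rot] is raised to a
    positive power. *)
Definition off_axis a t :=
  [forall j, forall m, (m != ord0) && (is_var a j m == 0%N) ==> (mexp t j m == 0%N)].

Lemma rot_curve_val a s t : rot_curve a s t =
  sqrt_mult t * ((off_axis a t)%:R * (cos s ^+ mexp t (tag a) ord0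
    * sin s ^+ mexp t (tag a) (lift ord0 (tagged a)))).
Proof.
rewrite ffunE; under eq_bigr do rewrite lpowE.
rewrite big_split /=; congr (_ * _).
case: (boolP (off_axis a t)) => [/forallP h|].
  rewrite mul1r (bigD1 (tag a)) //= [X in _ * X]big1 ?mulr1 => [|j ja]; last first.
    rewrite eq_sym in ja; rewrite big1 // => m _; rewrite /rot /is_var (negbTE ja) /=.
    case: ifPn => [|m0]; first by rewrite expr1n.
    have /forallP/(_ m) := h j; rewrite /is_var (negbTE ja) m0 /= => /eqP.
    by rewrite /mexp => ->; rewrite expr0.
  rewrite big_ord_recl {1}/rot /= eqxx; congr (_ * _).
  rewrite (bigD1 (tagged a)) //= big1 ?mulr1 => [|m mk].
    by rewrite /rot /is_var /= !eqxx.
  have /forallP/(_ (lift ord0 m)) := h (tag a).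
  rewrite /rot /is_var /= eqxx eqSS (negbTE (mk : (m != tagged a :> nat))) /= => /eqP.
  by rewrite /mexp => ->; rewrite expr0.
case/forallPn => j /forallPn[m]; rewrite !negb_imply => /andP[/andP[m0 /eqP i0] tm].
rewrite mul0r (bigD1 j) //= (bigD1 m) //= /rot (negbTE m0) i0 expr0n.
by rewrite (negbTE (tm : (val (t j) m : nat) != 0%N)) !mul0r.
Qed.

Lemma off_axis_mexp a t j m : off_axis a t ->
  mexp t j (lift ord0 m) = (mexp t (tag a) (lift ord0 (tagged a)) * is_var a j (lift ord0 m))%N.
Proof.
move=> /forallP/(_ j)/forallP/(_ (lift ord0 m)); rewrite /=.
case: a => i k; rewrite /is_var /=; have [e|] := eqVneq i j; last by rewrite muln0 => _ /eqP.
subst j; rewrite eqSS; have [/val_inj ->|_] := eqVneq (m : nat) k; first by rewrite muln1.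
by rewrite muln0 => /eqP.
Qed.

(** On the support of the curve the exponent of x_a determines the index, since the degrees force
    the exponents of x_0. *)
Lemma off_axis_t0 a t :
  off_axis a t && (mexp t (tag a) (lift ord0 (tagged a)) == 0%N) = (t == t0).
Proof.
apply/andP/eqP => [[h /eqP h0]|->]; last first.
  split; last by rewrite mexp_t0.
  apply/forallP => j; apply/forallP => m; rewrite mexp_t0 /e0 /expo0.
  by apply/implyP => /andP[/negbTE ->].
have hm j m : mexp t j (lift ord0 m) = 0%N by rewrite (off_axis_mexp _ _ _ _ h) h0.
apply: mexp_inj => j m; rewrite mexp_t0 /e0 /expo0; case: (unliftP ord0 m) => [k ->|->] /=.
  by rewrite hm.
by rewrite -(mexp_sum t j) big_ord_recl big1 ?addn0.
Qed.

Lemma off_axis_t1 a t :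
  off_axis a t && (mexp t (tag a) (lift ord0 (tagged a)) == 1%N) = (t == t1 a).
Proof.
apply/andP/eqP => [[h /eqP h1]|->]; last first.
  split; last by rewrite mexp_t1 /e1 /is_var /= !eqxx.
  apply/forallP => j; apply/forallP => m; rewrite mexp_t1 /e1.
  by apply/implyP => /andP[/negbTE -> ->].
have hm j m : mexp t j (lift ord0 m) = is_var a j (lift ord0 m).
  by rewrite (off_axis_mexp _ _ _ _ h) h1 mul1n.
apply: mexp_inj => j m; rewrite mexp_t1 /e1; case: (unliftP ord0 m) => [k ->|->] /=.
  by rewrite hm.
by have := mexp_sum t j; rewrite big_ord_recl (eq_bigr _ (fun m _ => hm j m)) sum_is_var; lia.
Qed.

Lemma rot_curve0 a : rot_curve a 0 = E R.
Proof.
apply/ffunP => t; rewrite rot_curve_val cos0 sin0 expr1n mul1r expr0n -natrM mulnb.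
rewrite off_axis_t0 E_val; case: eqP => [->|_]; last by rewrite mulr0.
by rewrite sqrt_mult_t0 mulr1.
Qed.

(** At 0 the powers of cos have derivative 0 and sin^k has derivative 1 only for k = 1. So only the
    coordinate [t1 a] moves, with speed [sqrt_mult (t1 a)]. *)
Lemma velocity_rot_curve a : velocity (rot_curve a) (Num.sqrt (d (tag a))%:R *: ebasis a).
Proof.
move=> t.
have hc k : der (fun s => cos s ^+ k) 0.
  by have := der_exp _ _ k (is_derive_cos (0 : R)); rewrite sin0 oppr0 mulr0.
have hs k : der (fun s => sin s ^+ k) (k == 1%N)%:R.
  have := der_exp _ _ k (is_derive_sin (0 : R)); rewrite sin0 cos0 mulr1.
  by case: k => [|[|k]] /=; rewrite ?mul0r ?mulr1 // expr0n mulr0.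
have := der_mul _ _ _ _ (der_cst (sqrt_mult t)) (der_mul _ _ _ _ (der_cst (off_axis a t)%:R)
   (der_mul _ _ _ _ (hc (mexp t (tag a) ord0)) (hs (mexp t (tag a) (lift ord0 (tagged a)))))).
rewrite !mulr0 !addr0 cos0 expr1n mul1r -natrM mulnb off_axis_t1.
move=> h; have -> : (Num.sqrt (d (tag a))%:R *: ebasis a : vec R r n d) t =
    sqrt_mult t * (t == t1 a)%:R.
  rewrite [LHS]ffunE ebasis_val /GRing.scale /=.
  by case: eqP => [->|_]; rewrite ?mulr0 // sqrt_mult_t1.
by apply: der_ext h => s; rewrite rot_curve_val.
Qed.

End Tangent.

(** * Linearity of the inner product and of factor replacement *)

Section Linearity.
Context {R : realType} {r : nat} {n d : 'I_r -> nat}.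
Implicit Types (x y : vec R r n d).

Lemma ipDr x y z : ip x (y + z) = ip x y + ip x z.
Proof. by rewrite /ip -big_split; apply: eq_bigr => t _; rewrite ffunE mulrDr. Qed.

Lemma ipZr x k y : ip x (k *: y) = k * ip x y.
Proof. by rewrite /ip mulr_sumr; apply: eq_bigr => t _; rewrite ffunE mulrCA. Qed.

Lemma ip_sumr x (I : finType) (A : pred I) (F : I -> vec R r n d) :
  ip x (\sum_(i | A i) F i) = \sum_(i | A i) ip x (F i).
Proof.
rewrite /ip exchange_big; apply: eq_bigr => t _ /=.
by rewrite sum_ffunE mulr_sumr.
Qed.

Lemma replD i p q : repl R r n d i (p + q) = repl R r n d i p + repl R r n d i q.
Proof. by apply/ffunP => t; rewrite !ffunE mulrDl. Qed.

Lemma replZ i k q : repl R r n d i (k *: q) = k *: repl R r n d i q.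
Proof. by apply/ffunP => t; rewrite !ffunE -mulrA. Qed.

Lemma repl_sum i (I : finType) (A : pred I) F :
  repl R r n d i (\sum_(k | A k) F k) = \sum_(k | A k) repl R r n d i (F k).
Proof.
apply/ffunP => t; rewrite ffunE sum_ffunE mulr_suml sum_ffunE.
by apply: eq_bigr => k _; rewrite ffunE.
Qed.

End Linearity.

(** * The derivative of a tangent field at E, paired with the normal components *)

Section SecondOrder.
Context {R : realType} {r : nat} {n d : 'I_r -> nat}.
Hypothesis hd : forall i, (0 < d i)%N.
Implicit Types (t u v w : tidx r n d) (c : {i : 'I_r & 'I_(n i)}).
Local Notation t0 := (@t0 r n d).
Local Notation t1 := (t1 hd).
Local Notation ord2 := (@ord2 r n d).
Local Notation e2 := (@e2 r n d).

Lemma ip_delta (x : vec R r n d) t : ip x (delta R r n d t) = x t.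
Proof.
rewrite (ip_single _ _ t) => [|u /negbTE ut]; rewrite ffunE ?ut //.
by rewrite eqxx mulr1.
Qed.

Lemma spanb_delta (A : pred (tidx r n d)) t : A t -> spanb R r n d A (delta R r n d t).
Proof.
move=> At; exists (fun u => (u == t)%:R).
rewrite (bigD1 t) //= eqxx scale1r big1 ?addr0 // => u /andP[_ /negbTE ->].
by rewrite scale0r.
Qed.

Lemma normal_t0 (P : vec R r n d) : inNormalE P -> P t0 = 0.
Proof.
case=> + _; rewrite (ip_single _ _ t0) => [|u /negbTE ut]; rewrite E_val ?ut //.
by rewrite eqxx mulr1.
Qed.

(** The rotation curve makes a positive multiple of [ebasis c] tangent, and normality kills the
    pairing with it. *)
Lemma normal_t1 (P : vec R r n d) c : inNormalE P -> P (t1 c) = 0.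
Proof.
case=> _ /(_ (Num.sqrt (d (tag c))%:R *: ebasis c)); rewrite ipZr => h.
have /h/eqP : tangent (E R) (Num.sqrt (d (tag c))%:R *: ebasis c : vec R r n d).
  exists (rot_curve c); split; first exact: rot_curve_inX.
  by split; [exact: rot_curve0 | exact: velocity_rot_curve].
rewrite mulf_eq0 gt_eqF ?sqrtr_gt0 ?ltr0n //= => /eqP.
rewrite (ip_single _ _ (t1 c)) => [|u /negbTE ut]; rewrite (ebasis_val hd) ?ut //.
by rewrite eqxx mulr1.
Qed.

(** The basis vector at [t] lies in some W_i when both variables sit in the same factor, and in some
    G_{i,j} otherwise; [P] is orthogonal to each. *)
Lemma inP_t2 (P : vec R r n d) t c c' : inP P -> ord2 c c' ->
  (forall j m, mexp t j m = e2 c c' j m) -> P t = 0.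
Proof.
case=> _ [PW PG] o h; rewrite -ip_delta.
have hk k : tag c != k -> tag c' != k -> a0 r n d t k = d k.
  move=> /negbTE ck /negbTE c'k.
  by rewrite [LHS]h /e2 /= ck c'k !subn0.
have [e|cc'] := eqVneq (tag c) (tag c').
  apply: (PW (tag c)); apply: spanb_delta; apply/andP; split.
    have := o (tag c); rewrite [a0 _ _ _ _ _]h /e2 /= -e eqxx /=; lia.
  by apply/forallP => k; apply/implyP => kc; rewrite hk // -?e eq_sym.
have hc : (a0 r n d t (tag c) + 1 == d (tag c))%N.
  have := hd (tag c).
  rewrite [a0 _ _ _ _ _]h /e2 /= eqxx [tag c' == _]eq_sym (negbTE cc') /=; lia.
have hc' : (a0 r n d t (tag c') + 1 == d (tag c'))%N.
  have := hd (tag c').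
  rewrite [a0 _ _ _ _ _]h /e2 /= eqxx (negbTE cc') /=; lia.
(* G_{i,j} is indexed by i < j, whereas [c] and [c'] come in either order. *)
have := cc'; rewrite -(inj_eq val_inj) /= neq_ltn => /orP[lt|lt].
  apply: (PG _ _ _ lt); apply: spanb_delta; rewrite hc hc' /=.
  by apply/forallP => k; apply/implyP => /andP[kc kc']; rewrite hk // eq_sym.
apply: (PG _ _ _ lt); apply: spanb_delta; rewrite hc hc' /=.
by apply/forallP => k; apply/implyP => /andP[kc kc']; rewrite hk // eq_sym.
Qed.

Variables (a b : {i : 'I_r & 'I_(n i)}) (V : vec R r n d -> vec R r n d).
Variables (gam : R -> vec R r n d) (D : vec R r n d).
Hypotheses (VT : tangent_field_nearE V) (VE : V (E R) = ebasis a).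
Hypotheses (gX : forall s, inX (gam s)) (g0 : gam 0 = E R) (gv : velocity gam (ebasis b)).
Hypothesis Vv : velocity (fun s => V (gam s)) D.

(** Take u = [t0] and w = [t1 c] in [field_quadric]. [E] is 1 at [t0] and 0 at the other three
    indices, and [ebasis] vanishes at [t0], so [D] survives only at [t]. *)
Lemma accel_split t v c :
  (forall j m, mexp t j m + mexp t0 j m = mexp v j m + mexp (t1 c) j m)%N ->
  t != t0 -> v != t0 ->
  ncoord D t = ncoord (ebasis a) (t1 c) * ncoord (ebasis b) v
    + ncoord (ebasis a) v * ncoord (ebasis b) (t1 c).
Proof.
move=> h /negbTE tn /negbTE vn.
have := field_quadric _ _ _ _ _ _ _ _ h VT gX g0 gv Vv.
have t10 c' : (t1 c' == t0) = false by exact/negbTE/t1_neq0.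
have t01 c' : (t0 == t1 c') = false by rewrite eq_sym t10.
rewrite VE !ncoord_E tn vn t10 eqxx /= !(ncoord_ebasis hd) !t01.
by rewrite ?(mul0r, mulr0, mul1r, add0r, addr0) => ->.
Qed.

(* The normalized second-order coordinate of D at x_c x_c'. *)
Definition accel c c' : R :=
  ((c == a) && (c' == b) + (c' == a) && (c == b))%:R
  / (Num.sqrt (d (tag c))%:R * Num.sqrt (d (tag c'))%:R).

Lemma ncoord_ebasis_t1 c c' :
  ncoord (ebasis c) (t1 c') = (c' == c)%:R * (Num.sqrt (d (tag c'))%:R)^-1 :> R.
Proof.
by rewrite (ncoord_ebasis hd) (inj_eq (t1_inj hd)); case: eqP => [->|_]; rewrite ?mul0r.
Qed.

Lemma accel_t2 t c c' : ord2 c c' -> (forall j m, mexp t j m = e2 c c' j m) ->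
  ncoord D t = accel c c'.
Proof.
move=> o h; rewrite (accel_split t (t1 c) c').
- rewrite !ncoord_ebasis_t1 /accel natrD -!mulnb !natrM invfM.
  by move: (_^-1) (_^-1) => x y; ring.
- exact: t2_quad.
- exact: t2_neq0 h.
- exact: t1_neq0.
Qed.

(** In every coordinate one factor is 0. [P] vanishes up to order one by normality and at order two
    by [inP_t2]; if [v] in the split of [t] is neither [t1 a] nor [t1 b], then [D] vanishes by
    [accel_split]. *)
Lemma ip_accel_inP (P : vec R r n d) : inP P -> ip D P = 0.
Proof.
move=> hP; have hN := hP.1; apply: big1 => t _.
have [->|tn] := eqVneq t t0; first by rewrite (normal_t0 _ hN) mulr0.
have [c [v h]] := t_split hd t tn.
have [e|vn] := eqVneq v t0.
  by rewrite e in h; rewrite (split_t0 hd _ _ h) (normal_t1 _ _ hN) mulr0.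
have D0 c' : v = t1 c' -> D t * P t = 0.
  move=> e; rewrite e in h; have [o h2] := split_t1 hd _ _ _ h.
  by rewrite (inP_t2 _ _ _ _ hP o h2) mulr0.
have [/D0//|va] := eqVneq v (t1 a); have [/D0//|vb] := eqVneq v (t1 b).
rewrite -(ncoordK D) (accel_split t v c h tn vn) !(ncoord_ebasis hd) (negbTE va) (negbTE vb).
by rewrite !(mul0r, mulr0, addr0).
Qed.

(** Here [y] is the plain monomial x_c x_c', with single coordinate 1 / [sqrt_mult], so pairing with
    it reads off [ncoord D]. *)
Lemma ip_t2 c c' (y : vec R r n d) : ord2 c c' ->
  (forall t, y t = if [forall j, forall m, mexp t j m == e2 c c' j m]
                   then (sqrt_mult t)^-1 else 0) ->
  ip D y = accel c c'.
Proof.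
move=> o h; have [t ht] := t2_exists c c' o.
rewrite (ip_single _ _ t) => [|u /negbTE ut]; rewrite h (same_exponents _ _ t ht) ?ut //.
by rewrite eqxx -(accel_t2 _ _ _ o ht).
Qed.

Lemma ip_expo2 i k l : (1 < d i)%N ->
  ip D (repl R r n d i (xmon R (n i) (d i) (expo2 (n i) (d i) k l)))
  = accel (Tagged (fun i => 'I_(n i)) k) (Tagged (fun i => 'I_(n i)) l).
Proof.
move=> d2; apply: ip_t2 => [j|t] /=.
  by have [<-|] := eqVneq i j.
apply: repl_xmon => [m|j]; first by rewrite /e2 /expo2 /is_var /= !eqxx /= -subnDA.
by rewrite eq_sym => /negbTE ij m; rewrite /e2 /e0 /expo0 /is_var /= ij !subn0.
Qed.

Lemma ip_Wvec i (fi : nat -> nat -> R) :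
  ip D (Wvec i fi) =
  Num.sqrt ((d i)%:R * ((d i)%:R - 1)) *
    \sum_(k < n i) \sum_(l < n i | (k < l)%N) fi k l *
      accel (Tagged (fun i => 'I_(n i)) k) (Tagged (fun i => 'I_(n i)) l)
  + Num.sqrt ((d i)%:R * ((d i)%:R - 1) / 2) *
    \sum_(k < n i) fi k k *
      accel (Tagged (fun i => 'I_(n i)) k) (Tagged (fun i => 'I_(n i)) k).
Proof.
rewrite /Wvec /fpoly replD ipDr !repl_sum !ip_sumr !mulr_sumr.
have [d2|d1] := ltnP 1 (d i).
  congr (_ + _); apply: eq_bigr => k _; last first.
    by rewrite replZ ipZr ip_expo2 // -mulrA mulrCA.
  rewrite repl_sum ip_sumr mulr_sumr; apply: eq_bigr => l _.
  by rewrite replZ ipZr ip_expo2 // -mulrA mulrCA.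
(* For d_i = 1 the exponent d_i - 2 is truncated, but every coefficient carries the factor d_i - 1 =
   0, so both sides vanish. *)
have -> : (d i)%:R = 1 :> R by rewrite (_ : d i = 1%N) //; apply/eqP; rewrite eqn_leq d1 hd.
rewrite subrr mulr0 mul0r sqrtr0; congr (_ + _); apply: eq_bigr => k _; last first.
  by rewrite replZ ipZr mulr0 !mul0r.
rewrite repl_sum ip_sumr mul0r big1 // => l _.
by rewrite replZ ipZr mulr0 mul0r.
Qed.

Lemma ip_Gvec i j (gij : nat -> nat -> R) : i != j ->
  ip D (Gvec i j gij) =
  Num.sqrt (d i)%:R * Num.sqrt (d j)%:R *
  \sum_(k < n i) \sum_(l < n j) gij k l *
      accel (Tagged (fun i => 'I_(n i)) k) (Tagged (fun i => 'I_(n i)) l).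
Proof.
move=> ij; rewrite /Gvec ip_sumr mulr_sumr; apply: eq_bigr => k _.
rewrite ip_sumr mulr_sumr; apply: eq_bigr => l _; rewrite ipZr mulrCA; congr (_ * _).
have -> : Eij R r n d i j k l = (Num.sqrt (d i)%:R * Num.sqrt (d j)%:R) *:
    repl2 R r n d i j (xmon R (n i) (d i) (expo1 (n i) (d i) k))
                      (xmon R (n j) (d j) (expo1 (n j) (d j) l)).
  by apply/ffunP => t; rewrite !ffunE /GRing.scale /=; ring.
(* As i and j differ, each factor loses x_0 at most once, and positive degrees give [ord2]. *)
rewrite ipZr; congr (_ * _); apply: ip_t2 => [m|t] /=.
  by have := hd m; have [<-|_] := eqVneq i m; rewrite ?[j == _]eq_sym ?(negbTE ij) //; case: (_ == _).
have /negbTE ji : j != i by rewrite eq_sym.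
apply: repl2_xmon => // [m|m|m].
- by rewrite /e2 /expo1 /is_var /= eqxx ji /= subn0 addn0.
- by rewrite /e2 /expo1 /is_var /= eqxx (negbTE ij) /= subn0.
rewrite eq_sym => /negbTE im; rewrite eq_sym => /negbTE jm x.
by rewrite /e2 /e0 /expo0 /is_var /= im jm !subn0.
Qed.

End SecondOrder.

(** * Kronecker-delta sums and square-root identities *)

Section Sums.
Context {R : realType}.

Lemma sum_upper_single m (h : 'I_m -> 'I_m -> R) (p q : 'I_m) :
  \sum_(k < m) \sum_(l < m | (k < l)%N) h k l * ((k == p) && (l == q))%:R
  = if (p < q)%N then h p q else 0.
Proof.
rewrite (bigD1 p) //= [X in _ + X]big1 ?addr0 => [|k /negbTE kp]; last first.
  by rewrite big1 // => l _; rewrite kp mulr0.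
case: ifPn => pq; last first.
  rewrite big1 // => l pl; rewrite eqxx /=; case: eqP => [lq|]; last by rewrite mulr0.
  by rewrite lq (negbTE pq) in pl.
rewrite (bigD1 q) //= !eqxx mulr1 big1 ?addr0 // => l /andP[_ /negbTE ->].
by rewrite andbF mulr0.
Qed.

(** An index pair with k < l matches (p,q) or (q,p), according to which of p and q is smaller. *)
Lemma sum_upper_pair m (h : 'I_m -> 'I_m -> R) (p q : 'I_m) (z : R) :
  \sum_(k < m) \sum_(l < m | (k < l)%N)
    h k l * (((k == p) && (l == q) + (l == p) && (k == q))%:R * z)
  = ((if (p < q)%N then h p q else 0) + (if (q < p)%N then h q p else 0)) * z.
Proof.
rewrite -!sum_upper_single -big_split mulr_suml; apply: eq_bigr => k _ /=.
rewrite -big_split mulr_suml; apply: eq_bigr => l _ /=.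
by rewrite mulrA -mulrDr -natrD [(l == p) && _]andbC.
Qed.

(** For p = q the two symmetric matches coincide, whence the factor 2. *)
Lemma sum_diag_pair m (h : 'I_m -> R) (p q : 'I_m) (z : R) :
  \sum_(k < m) h k * (((k == p) && (k == q) + (k == p) && (k == q))%:R * z)
  = (if p == q then h p * 2 else 0) * z.
Proof.
rewrite (bigD1 p) //= big1 ?addr0 => [|k /negbTE ->]; last by rewrite mul0r mulr0.
by rewrite eqxx; case: eqP => _ /=; rewrite ?mul0r ?mulr0 // mulrA.
Qed.

Lemma sum_single_pair m m' (h : 'I_m -> 'I_m' -> R) p q (z : R) :
  \sum_(k < m) \sum_(l < m') h k l * (((k == p) && (l == q))%:R * z) = h p q * z.
Proof.
rewrite (bigD1 p) //= [X in _ + X]big1 ?addr0 => [|k /negbTE ->]; last first.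
  by rewrite big1 // => l _; rewrite mul0r mulr0.
rewrite (bigD1 q) //= big1 ?addr0 => [|l /negbTE ->]; first by rewrite !eqxx mul1r.
by rewrite andbF mul0r mulr0.
Qed.

Lemma sqrt_ratio (x : R) : 1 <= x ->
  Num.sqrt (x * (x - 1)) / (Num.sqrt x * Num.sqrt x) = Num.sqrt ((x - 1) / x).
Proof.
move=> x1; have x0 : 0 < x := lt_le_trans ltr01 x1.
rewrite sqrtrM ?ltW // sqrtrM ?subr_ge0 // sqrtrV ?ltW //.
by field; rewrite gt_eqF // sqrtr_gt0.
Qed.

(** Combines the 1/2 under the root in the diagonal coefficients with the 2 of [sum_diag_pair] into
    c_kk = sqrt 2. *)
Lemma sqrt_half (x : R) : 0 <= x -> Num.sqrt (x / 2) * 2 = Num.sqrt x * Num.sqrt 2.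
Proof.
move=> x0; rewrite sqrtrM // sqrtrV // -{2}(sqr_sqrtr (ler0n R 2)).
by field; rewrite gt_eqF // sqrtr_gt0.
Qed.

End Sums.

(** * Assembly of the matrix entries *)

Lemma Tagged_eq {I : eqType} {T : I -> eqType} i (x y : T i) :
  (Tagged T x == Tagged T y) = (x == y).
Proof. by rewrite -tag_eqE /tag_eq eqxx tagged_asE. Qed.

Theorem theorem3p9 (R : realType) (r : nat) (n d : 'I_r -> nat)
  (hn : forall i, (0 < n i)%N) (hd : forall i, (0 < d i)%N)
  (f : 'I_r -> nat -> nat -> R)
  (hf : forall i (k l : 'I_(n i)), f i k l = f i l k)
  (g : 'I_r -> 'I_r -> nat -> nat -> R)
  (P F : vec R r n d) :
  inNormalE F ->
  inP P ->
  F = P + \sum_(i : 'I_r) Wvec i (f i)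
        + \sum_(i : 'I_r) \sum_(j : 'I_r | (i < j)%N) Gvec i j (g i j) ->
  forall (a b : {i : 'I_r & 'I_(n i)}) (V : vec R r n d -> vec R r n d)
         (gam : R -> vec R r n d) (D : vec R r n d),
    tangent_field_nearE V ->
    V ((E R)) = ebasis a ->
    (forall s, inX (gam s)) -> gam 0 = (E R) -> velocity gam (ebasis b) ->
    velocity (fun s => V (gam s)) D ->
    ip D F = Lmat d f g a b.
Proof.
move=> _ hP -> a b V gam D VT VE gX g0 gv Vv.
pose T := fun i => 'I_(n i).
rewrite !ipDr !ip_sumr (ip_accel_inP hd _ _ _ _ _ VT VE gX g0 gv Vv _ hP) add0r.
under eq_bigr do rewrite (ip_Wvec hd _ _ _ _ _ VT VE gX g0 gv Vv).
under [X in _ + X]eq_bigr => i _.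
  rewrite ip_sumr; under eq_bigr => j ij.
    rewrite (ip_Gvec hd _ _ _ _ _ VT VE gX g0 gv Vv); last by rewrite neq_ltn ij.
    over.
  over.
clear VT VE gX g0 gv Vv hP; case: a b => [i k] [j l].
set A := existT _ i k; set B := existT _ j l; rewrite /Lmat /=.
pose acc i' j' (k' : 'I_(n i')) (l' : 'I_(n j')) : R :=
  @accel R r n d A B (Tagged T k') (Tagged T l').
(* A second-order coordinate of [D] can be nonzero only in the factor pair {i, j} of the two basis
   vectors. *)
have acc0 i' j' (k' : 'I_(n i')) (l' : 'I_(n j')) :
    (i' == i) && (j' == j) = false -> (j' == i) && (i' == j) = false ->
    acc i' j' k' l' = 0.
  move=> h h'; rewrite /acc /accel (_ : (Tagged T k' == A) && (Tagged T l' == B) = false).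
    rewrite (_ : (Tagged T l' == A) && (Tagged T k' == B) = false) ?mul0r //.
    apply: contraFF h' => /andP[/eqP/(congr1 tag)/= -> /eqP/(congr1 tag)/= ->].
    by rewrite !eqxx.
  apply: contraFF h => /andP[/eqP/(congr1 tag)/= -> /eqP/(congr1 tag)/= ->].
  by rewrite !eqxx.
have sq_neq0 x : Num.sqrt (d x)%:R != 0 :> R by rewrite gt_eqF // sqrtr_gt0 ltr0n.
(* Diagonal blocks: all G terms and all W terms except W_i drop out. *)
have [e|ij] := eqVneq i j.
  subst j.
  rewrite [X in _ + X]big1 ?addr0 => [|i' _]; last first.
    rewrite big1 // => j' lt; rewrite big1 ?mulr0 // => k' _; rewrite big1 // => l' _.
    have h : (i' == i) && (j' == i) = false.
      by apply: contraTF lt => /andP[/eqP -> /eqP ->]; rewrite ltnn.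
    by rewrite [accel _ _ _ _]acc0 ?mulr0 // andbC.
  rewrite (bigD1 i) //= [X in _ + X]big1 ?addr0 => [|i' /negbTE ii]; last first.
    rewrite [X in _ * X]big1 => [|k' _]; last first.
      by rewrite big1 // => l' _; rewrite [accel _ _ _ _]acc0 ?ii ?mulr0.
    rewrite [X in _ + _ * X]big1 => [|k' _]; first by rewrite !mulr0 addr0.
    by rewrite [accel _ _ _ _]acc0 ?ii ?mulr0.
  have accE (k' l' : 'I_(n i)) : acc i i k' l' =
      ((k' == k) && (l' == l) + (l' == k) && (k' == l))%:R
      * (Num.sqrt (d i)%:R * Num.sqrt (d i)%:R)^-1.
    by rewrite /acc /accel !Tagged_eq.
  under eq_bigr do under eq_bigr do rewrite [accel _ _ _ _]accE.
  rewrite sum_upper_pair.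
  under [X in _ + _ * X]eq_bigr do rewrite [accel _ _ _ _]accE.
  rewrite sum_diag_pair.
  have d1 : 1 <= (d i)%:R :> R by rewrite ler1n.
  rewrite -(sqrt_ratio _ d1) -(inj_eq val_inj k l) /=.
  have [kl|kl|/val_inj kl] := ltngtP k l; rewrite /= ?addr0 ?add0r ?mul0r ?mulr0 ?addr0.
  - ring.
  (* For l < k the sum contains f_{i,(l,k)}, and the symmetry of [f] turns it into the required
     entry. *)
  - by rewrite hf; ring.
  - rewrite add0r kl mulrA [_ * 2]mulrC mulrA sqrt_half; first ring.
    by rewrite mulr_ge0 ?subr_ge0.
(* Stated for an arbitrary ordered pair i' < j', so as to serve both i < j and j < i; the
   normalization of [accel] cancels sqrt(d_i') sqrt(d_j'). *)
have Gsum (i' j' : 'I_r) (p : 'I_(n i')) (q : 'I_(n j')) : (i' < j')%N ->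
    (forall k' l', acc i' j' k' l' =
      ((k' == p) && (l' == q))%:R / (Num.sqrt (d i')%:R * Num.sqrt (d j')%:R)) ->
    (forall x y : 'I_r, (x < y)%N -> (x == i') && (y == j') = false ->
      forall k' l', acc x y k' l' = 0) ->
    \sum_(x < r) \sum_(y < r | (x < y)%N) Num.sqrt (d x)%:R * Num.sqrt (d y)%:R *
      (\sum_(k' < n x) \sum_(l' < n y) g x y k' l' * acc x y k' l') = g i' j' p q.
  move=> lt h h0; rewrite (bigD1 i') //= [X in _ + X]big1 ?addr0 => [|x /negbTE xi]; last first.
    rewrite big1 // => y xy; rewrite big1 ?mulr0 // => k' _; rewrite big1 // => l' _.
    by rewrite h0 ?mulr0 // xi.
  rewrite (bigD1 j') //= [X in _ + X]big1 ?addr0 => [|y /andP[xy /negbTE yj]]; last first.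
    rewrite big1 ?mulr0 // => k' _; rewrite big1 // => l' _.
    by rewrite h0 ?mulr0 // yj andbF.
  under eq_bigr do under eq_bigr do rewrite h.
  by rewrite sum_single_pair mulrC divfK // mulf_neq0.
(* Off-diagonal blocks: a W term involves one factor, which cannot be both i and j. *)
rewrite big1 ?add0r => [|i' _]; last first.
  have h : (i' == i) && (i' == j) = false.
    by apply: contraNF ij => /andP[/eqP -> /eqP ->].
  rewrite [X in _ * X]big1 => [|k' _]; last first.
    by rewrite big1 // => l' _; rewrite [accel _ _ _ _]acc0 ?mulr0 //.
  rewrite [X in _ + _ * X]big1 => [|k' _]; first by rewrite !mulr0 addr0.
  by rewrite [accel _ _ _ _]acc0 ?mulr0.
have Tneq x y (p : 'I_(n x)) (q : 'I_(n y)) : x != y -> (Tagged T p == Tagged T q) = false.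
  by apply: contraNF => /eqP/(congr1 tag)/= ->.
have ji : j != i by rewrite eq_sym.
have := ij; rewrite -(inj_eq val_inj) neq_ltn => /orP[lt|lt].
  rewrite lt; apply: Gsum => // [k' l'|x y xy h k' l'].
    by rewrite /acc /accel !Tagged_eq (Tneq _ _ l' k ji) addn0.
  apply: acc0 h _; apply: contraTF xy => /andP[/eqP -> /eqP ->].
  by rewrite -leqNgt ltnW.
(* For j < i the match is at (l,k), which gives the transposed block. *)
rewrite ltnNge (ltnW lt); apply: Gsum => // [k' l'|x y xy h k' l'].
  by rewrite /acc /accel (Tneq _ _ k' k ji) !Tagged_eq [(l' == k) && _]andbC.
apply: acc0 _; last by rewrite andbC.
by apply: contraTF xy => /andP[/eqP -> /eqP ->]; rewrite -leqNgt ltnW.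
Qed.
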